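(* Let $\alpha\in\mathbb{R}\setminus\mathbb{Q}$ be amply approximable and let $\beta>0$. Then $F(\alpha,\beta)=\{(j,k)\in\mathbb{Z}^2:|k-j\alpha|<\beta\}$ has Property A, i.e. $\mathfrak{T}_2^{p}(F-F)=\mathfrak{U}_2(F)$ for $F=F(\alpha,\beta)$.
   Context: $T=\mathbb{R}/\mathbb{Z}$, $e_{j,k}(x,y)=e^{2\pi i(jx+ky)}$. $\mathfrak{T}_2$ is the algebra of trigonometric polynomials on $T^2$; for $t\in\mathfrak{T}_2$, $\mathrm{freq}(t)$ is the set of $(j,k)$ whose Fourier coefficient is nonzero. For $F\subseteq\mathbb{Z}^2$: $\mathfrak{T}_2(F)=\{t\in\mathfrak{T}_2:\mathrm{freq}(t)\subseteq F\}$; $\mathfrak{T}_2^{p}(F)=\{t\in\mathfrak{T}_2(F): t>0 \text{ everywhere on } T^2\}$; $\mathfrak{S}_2(F)=\{|t|^2:t\in\mathfrak{T}_2(F)\}$; $\mathfrak{U}_2(F)=\mathfrak{T}_2\cap\mathrm{cl}(\mathfrak{S}_2(F))$, closure in $C(T^2)$ with the supremum norm; $F-F=\{a-b:a,b\in F\}$. $F$ has Property A if $\mathfrak{T}_2^{p}(F-F)=\mathfrak{U}_2(F)$. An irrational $\alpha$ is amply approximable if there is a sequence of matrices $g=\begin{pmatrix} g_{11}&g_{12}\\ g_{21}&g_{22}\end{pmatrix}\in SL(2,\mathbb{Z})$ with $|g_{22}|\to\infty$ and $|g_{21}+\alpha g_{22}|\,|g_{22}|\,\log|g_{22}|\to 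0$.
   Formalization: ''t > 0 everywhere'' in the definition of T_2^p(F) is read as t ≥ 0 everywhere; with strict positivity Property A fails for every F, since 0 = |0|^2 lies in U_2(F) but is not > 0. *)

(* Defs.v *)
From HB Require Import structures.
From mathcomp Require Import all_boot all_order all_algebra.
From mathcomp Require Import complex.
From mathcomp Require Import all_classical all_reals all_analysis.

Set Implicit Arguments.
Unset Strict Implicit.
Unset Printing Implicit Defensive.

Import Order.TTheory GRing.Theory Num.Theory.
Import numFieldNormedType.Exports.

Local Open Scope classical_set_scope.
Local Open Scope ring_scope.
Local Open Scope complex_scope.

(* Functions on T^2, T = R/Z, are Z^2-periodic functions R * R -> R[i].
   Every element of [trig_poly] is periodic, so the supremum over T^2 is the
   supremum over R * R, and the integral over T^2 is the integral over the
   unit square. The order on R[i] is the one of MathComp: 0 <= z holds iff z is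
   real and nonnegative; the norm `|z| is the modulus, seen in R[i]. *)

(* e^(2 pi i (j x + k y)) for m = (j, k) and z = (x, y) *)
Definition e_ {R : realType} (m : int * int) (z : R * R) : R[i] :=
  let a := 2 * pi * (m.1%:~R * z.1 + m.2%:~R * z.2) in cos a +i* sin a.

(* [s] may repeat frequencies: this is the linear span of the characters. *)
Definition trig_poly {R : realType} : set (R * R -> R[i]) :=
  [set t | exists (s : seq (int * int)) (c : int * int -> R[i]),
     forall z, t z = \sum_(m <- s) c m * e_ m z].

Definition integral_T2 {R : realType} (f : R * R -> R[i]) : R[i] :=
  let mu := (@lebesgue_measure R \x @lebesgue_measure R)%E in
  let Q := `[0, 1]%classic `*` `[0, 1]%classic in
  Rintegral mu Q (fun z => complex.Re (f z))
    +i* Rintegral mu Q (fun z => complex.Im (f z)).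

Definition fourier_coef {R : realType} (t : R * R -> R[i]) (m : int * int)
    : R[i] :=
  integral_T2 (fun z => t z * (e_ m z)^*).

Definition freq {R : realType} (t : R * R -> R[i]) : set (int * int) :=
  [set m | fourier_coef t m != 0].

Definition trig_poly_in {R : realType} (F : set (int * int))
    : set (R * R -> R[i]) :=
  [set t | trig_poly t /\ freq t `<=` F].

(* "Positive" means t >= 0: the zero polynomial belongs to [U2 F] for every F,
   so strict positivity would make [property_A] below unsatisfiable. *)
Definition pos_trig_poly_in {R : realType} (F : set (int * int))
    : set (R * R -> R[i]) :=
  [set t | trig_poly_in F t /\ forall z, 0 <= t z].

Definition squares {R : realType} (F : set (int * int))
    : set (R * R -> R[i]) :=
  [set s | exists2 t, trig_poly_in F t & s = (fun z => `|t z| ^+ 2)].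

(* The closure is taken for the topology of uniform convergence on R * R,
   which induces on C(T^2) the topology of the supremum norm. *)
Definition U2 {R : realType} (F : set (int * int)) : set (R * R -> R[i]) :=
  trig_poly `&` closure (squares F : set {uniform (R * R) -> (R[i])^o}).

Definition diff_set (F : set (int * int)) : set (int * int) :=
  [set a - b | a in F & b in F].

Definition property_A (R : realType) (F : set (int * int)) : Prop :=
  @pos_trig_poly_in R (diff_set F) = U2 F.

(* Meant for irrational alpha; [ln 0 = 0] is harmless since |g22| -> +oo. *)
Definition amply_approximable {R : realType} (alpha : R) : Prop :=
  exists g : nat -> 'M[int]_2,
    let g21 n : R := (g n 1 0)%:~R in
    let g22 n : R := (g n 1 1)%:~R in
    [/\ forall n, \det (g n) = 1,
        `|g22 n| @[n --> \oo] --> +oo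
      & `|g21 n + alpha * g22 n| * `|g22 n| * ln `|g22 n| @[n --> \oo]
          --> (0 : R)].

Definition strip {R : realType} (alpha beta : R) : set (int * int) :=
  [set m | `|m.2%:~R - m.1%:~R * alpha| < beta].

(* Main.v *)
(* Write h(j,k) = k - j alpha and F for the strip |h| < beta.  The inclusion U_2(F) in
   T_2^p(F - F) is the continuity of Fourier coefficients.

   Conversely let t >= 0 have its frequencies in |h| <= l, with l < 2 beta.  Up to a
   small constant and a scaling, t = 1 - f with 0 <= f <= rho < 1.  Since f^n has O(n^2)
   frequencies and coefficients O(rho^n), u = sum_n f^n / n converges absolutely in the
   Wiener algebra, and 1 - f = exp(- u).  Split u = b + conj b with b supported in
   h >= 0, and put Q = exp(- b), so that |Q|^2 = 1 - f.  Then Q is supported in h >= 0,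
   but also Q = (1 - f) exp(conj b) is supported in h <= l.  As the values of h are dense,
   some m0 has l - beta < h(m0) < beta, and e_{-m0} Q has its frequencies in F.  To stay
   among trigonometric polynomials, one truncates the series for log and exp; the errors
   are measured in the Wiener norm, for which restricting the frequencies to a half-plane
   is a contraction. *)
Require Import Defs.
From mathcomp Require Import all_boot all_order all_algebra.
From mathcomp Require Import complex zify ring lra.
From mathcomp Require Import all_classical all_reals all_analysis measurable_realfun.

Set Implicit Arguments.
Unset Strict Implicit.
Unset Printing Implicit Defensive.

Import Order.TTheory GRing.Theory Num.Theory.
Import numFieldNormedType.Exports.

Local Open Scope classical_set_scope.
Local Open Scope complex_scope.
Local Open Scope ring_scope.

(** * Characters *)

Section characters.
Variable R : realType.
Implicit Types (m n : int * int) (z : R * R) (f g : R * R -> R[i]).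

(** The norm of [R[i]] takes values in [R[i]]; this copy in [R] lets bounds be handled in a totally
    ordered field. *)
Definition nrm (x : R[i]) : R := complex.Re `|x|.

Lemma nrmE (x : R[i]) : (nrm x)%:C = `|x|.
Proof. by rewrite /nrm normc_def. Qed.

Lemma nrm_ge0 (x : R[i]) : 0 <= nrm x.
Proof. by rewrite -lecR nrmE; exact: normr_ge0. Qed.

Lemma nrmM (x y : R[i]) : nrm (x * y) = nrm x * nrm y.
Proof. by apply/complexI; rewrite rmorphM /= !nrmE normrM. Qed.

Lemma nrmD (x y : R[i]) : nrm (x + y) <= nrm x + nrm y.
Proof. by rewrite -lecR rmorphD /= !nrmE ler_normD. Qed.

Lemma nrmN (x : R[i]) : nrm (- x) = nrm x.
Proof. by apply/complexI; rewrite !nrmE normrN. Qed.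

Lemma nrmJ (x : R[i]) : nrm x^* = nrm x.
Proof. by rewrite /nrm norm_conjC. Qed.

Lemma nrmR (a : R) : nrm a%:C = `|a|.
Proof.
by apply/complexI; rewrite nrmE normc_def /= expr0n /= addr0 sqrtr_sqr.
Qed.

Lemma nrm0 : nrm 0 = 0. Proof. by rewrite /nrm normr0. Qed.
Lemma nrm1 : nrm 1 = 1. Proof. by rewrite /nrm normr1. Qed.

Lemma nrm_sum (I : Type) (r : seq I) (P : pred I) (F : I -> R[i]) :
  nrm (\sum_(i <- r | P i) F i) <= \sum_(i <- r | P i) nrm (F i).
Proof.
apply: (big_ind2 (fun x y => nrm x <= y)) => //; first by rewrite nrm0.
by move=> *; apply: (le_trans (nrmD _ _)); exact: lerD.
Qed.

Lemma nrmX (x : R[i]) (n : nat) : nrm (x ^+ n) = nrm x ^+ n.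
Proof. by elim: n => [|n IH]; rewrite ?expr0 ?nrm1// !exprS nrmM IH. Qed.

Lemma Re_le_nrm (x : R[i]) : `|complex.Re x| <= nrm x.
Proof.
rewrite /nrm normc_def /= -sqrtr_sqr ler_wsqrtr// lerDl; exact: sqr_ge0.
Qed.

Lemma Im_le_nrm (x : R[i]) : `|complex.Im x| <= nrm x.
Proof.
rewrite /nrm normc_def /= -sqrtr_sqr ler_wsqrtr// lerDr; exact: sqr_ge0.
Qed.

Lemma nrm_le (x : R[i]) : nrm x <= `|complex.Re x| + `|complex.Im x|.
Proof.
case: x => a b; rewrite [X in nrm X]complexE.
apply: (le_trans (nrmD _ _)); rewrite nrmM !nrmR /= lerD//.
by rewrite /nrm normc_def /= expr0n expr1n add0r sqrtr1 mul1r.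
Qed.

Lemma e_D m n z : e_ (m + n) z = e_ m z * e_ n z.
Proof.
rewrite /e_ /=; set a := 2 * pi * (m.1%:~R * _ + _).
set b := 2 * pi * (n.1%:~R * _ + _).
have -> : 2 * pi * ((m.1 + n.1)%:~R * z.1 + (m.2 + n.2)%:~R * z.2) = a + b.
  by rewrite /a /b !intrD; ring.
by rewrite cosD sinD; congr (_ +i* _); rewrite addrC mulrC.
Qed.

Lemma e_N m z : e_ (- m) z = (e_ m z)^*.
Proof.
by rewrite /e_ /= !intrN !mulNr -opprD mulrN cosN sinN.
Qed.

Lemma e_0 z : e_ 0 z = 1.
Proof. by rewrite /e_ /= !mul0r addr0 mulr0 cos0 sin0. Qed.

Lemma nrm_e m z : nrm (e_ m z) = 1.
Proof.
by rewrite /nrm normc_def /e_ /= cos2Dsin2 sqrtr1.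
Qed.

End characters.

(** * Integration over the torus *)

Section integral.
Variable R : realType.
Implicit Types (m n : int * int) (z : R * R) (f g : R * R -> R[i]).
Notation mu := (@lebesgue_measure R).
Notation I := (`[0, 1]%classic : set R).

Lemma integrable_unit_itv (g : R -> R) : continuous g ->
  mu.-integrable I (EFin \o g).
Proof.
move=> cg; apply: continuous_compact_integrable; first exact: segment_compact.
exact: continuous_subspaceT.
Qed.

Lemma Rintegral_FTC (g G : R -> R) : continuous g ->
    (forall x : R, is_derive x (1 : R) G (g x)) ->
  \int[mu]_(x in I) g x = G 1 - G 0.
Proof.
move=> cg dG.
have cG : continuous G.
  by move=> x; apply/differentiable_continuous/derivable1_diffP; case: (dG x).
rewrite /Rintegral (@continuous_FTC2 _ g G) //.
- exact: continuous_subspaceT.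
- split; first by move=> x _; case: (dG x).
  + apply: cvg_at_right_filter; exact: cG.
  + apply: cvg_at_left_filter; exact: cG.
- by move=> x _; rewrite derive1E; apply: derive_val.
Qed.

Let tp (j : int) : R := 2 * pi * j%:~R.

Lemma cos_tp j : cos (tp j) = 1 /\ sin (tp j) = 0.
Proof.
have H (n : nat) : cos (tp n%:Z) = 1 /\ sin (tp n%:Z) = 0.
  rewrite /tp -pmulrn (_ : _ * _ = 0 + (pi *+ 2) *+ n); last first.
    by rewrite add0r -[RHS]mulr_natr -[pi *+ 2]mulr_natr (mulrC pi).
  by rewrite (periodicn (@cosD2pi R)) (periodicn (@sinD2pi R)) cos0 sin0.
case: j => n; first exact: H.
have := H n.+1; rewrite NegzE /tp rmorphN /= mulrN cosN sinN => -[-> ->].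
by rewrite oppr0.
Qed.

Lemma continuous_cosM (a : R) : continuous (fun x : R => cos (a * x)).
Proof.
move=> x; apply: (@continuous_comp _ _ _ (fun x => a * x) cos).
  exact: mulrl_continuous.
exact: continuous_cos.
Qed.

Lemma continuous_sinM (a : R) : continuous (fun x : R => sin (a * x)).
Proof.
move=> x; apply: (@continuous_comp _ _ _ (fun x => a * x) sin).
  exact: mulrl_continuous.
exact: continuous_sin.
Qed.

Lemma tp_eq0 j : (tp j == 0) = (j == 0).
Proof. by rewrite /tp mulf_eq0 intr_eq0 mulf_eq0 pnatr_eq0 /= gt_eqF ?pi_gt0. Qed.

Lemma Rintegral_cos_tp j :
  \int[mu]_(x in I) cos (tp j * x) = (j == 0)%:R.
Proof.
have [->|j0] := eqVneq j 0.
  have dG (x : R) : is_derive x (1 : R) id (cos (tp 0 * x)).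
    by rewrite /tp mulr0 mul0r cos0; exact: is_derive_id.
  by rewrite (Rintegral_FTC (@continuous_cosM _) dG) subr0.
have dG (x : R) :
    is_derive x (1 : R) (fun x => (tp j)^-1 * sin (tp j * x)) (cos (tp j * x)).
  apply: is_derive_eq.
  rewrite /GRing.scale /= !mulr1 ?mulr0 ?add0r ?addr0.
  by rewrite mulrCA mulVf ?mulr1 ?tp_eq0.
rewrite (Rintegral_FTC (@continuous_cosM _) dG).
by rewrite mulr1 mulr0 sin0 (cos_tp j).2 !mulr0 subr0.
Qed.

Lemma Rintegral_sin_tp j : \int[mu]_(x in I) sin (tp j * x) = 0.
Proof.
have [->|j0] := eqVneq j 0.
  have dG (x : R) : is_derive x (1 : R) (cst 0) (sin (tp 0 * x)).
    by rewrite /tp mulr0 mul0r sin0; exact: is_derive_cst.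
  by rewrite (Rintegral_FTC (@continuous_sinM _) dG) subr0.
have dG (x : R) :
    is_derive x (1 : R) (fun x => - (tp j)^-1 * cos (tp j * x)) (sin (tp j * x)).
  apply: is_derive_eq.
  rewrite /GRing.scale /= !mulr1 ?mulr0 ?add0r ?addr0.
  by rewrite !mulNr mulrN opprK mulrCA mulVf ?tp_eq0// mulr1.
rewrite (Rintegral_FTC (@continuous_sinM _) dG).
by rewrite mulr1 mulr0 cos0 (cos_tp j).1 subrr.
Qed.

Lemma measurable_unit_square :
  measurable (I `*` I : set (measurableTypeR R * measurableTypeR R)).
Proof. exact: measurableX. Qed.

Lemma unit_square_measure : (mu \x mu)%E (I `*` I) = 1%E.
Proof.
have m1 : mu I = 1%E by rewrite lebesgue_measure_itv /= lte_fin ltr01 sube0.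
by rewrite -[RHS]mul1e -m1; exact: product_measure1E.
Qed.

Lemma integrable_unit_square (F : R * R -> R) (M : R) :
  measurable_fun setT F -> (forall z, `|F z| <= M) ->
  (mu \x mu)%E.-integrable (I `*` I) (EFin \o F).
Proof.
move=> mF bF; apply: measurable_bounded_integrable.
- exact: measurableX.
- by rewrite [X in (X < _)%E]unit_square_measure ltry.
- exact: measurable_funTS.
- by exists M; split; [exact: num_real|move=> x Mx z _ /=; exact: le_trans (bF z) (ltW Mx)].
Qed.

(** Fubini for the integrand extended by zero outside the square; the bounds by 1 make it integrable
    there. *)
Lemma Rintegral_prod (g h : R -> R) : continuous g -> continuous h ->
    (forall x, `|g x| <= 1) -> (forall x, `|h x| <= 1) ->
  \int[(mu \x mu)%E]_(z in I `*` I) (g z.1 * h z.2) =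
  (\int[mu]_(x in I) g x) * (\int[mu]_(x in I) h x).
Proof.
move=> cg ch bg bh.
have mI : measurable I by [].
have ig := integrable_unit_itv cg. have ih := integrable_unit_itv ch.
rewrite /Rintegral integral_mkcond -integral12_prod_meas1; last first.
  apply/(integrable_restrict (mu \x mu)%E); rewrite ?setTI//.
    exact: measurableX.
  apply: (@integrable_unit_square (fun z => g z.1 * h z.2) 1).
    apply: measurable_funM.
      by apply: measurableT_comp => //; exact: continuous_measurable_fun.
    by apply: measurableT_comp => //; exact: continuous_measurable_fun.
  by move=> z; rewrite normrM mulr_ile1.
rewrite -fineM; [|exact: integrable_fin_num ig|exact: integrable_fin_num ih].
congr fine.
have fh : (\int[mu]_(x in I) (h x)%:E \is a fin_num)%E by exact: integrable_fin_num ih.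
rewrite -[X in (_ * X)%E](fineK fh) -integralZr//.
rewrite [RHS]integral_mkcond; apply: eq_integral => x _.
rewrite /fubini_F /= patchE.
case: ifPn => xI.
  rewrite (fineK fh) -integralZl //.
  rewrite [RHS]integral_mkcond; apply: eq_integral => y _.
  by rewrite !patchE in_setX /= xI; case: ifPn.
by apply: integral0_eq => y _; rewrite patchE in_setX /= (negbTE xI).
Qed.

Lemma Rintegral_prod_bnd (F : R * R -> R) (M : R) :
  measurable_fun setT F -> (forall z, `|F z| <= M) ->
  `|\int[(mu \x mu)%E]_(z in I `*` I) F z| <= M.
Proof.
move=> mF bF.
have mI := measurable_unit_square.
apply: (le_trans (le_normr_Rintegral mI (integrable_unit_square mF bF))).
rewrite (_ : M = \int[(mu \x mu)%E]_(z in I `*` I) M).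
  apply: le_Rintegral => //.
    apply: (@integrable_unit_square (fun z => `|F z|) M).
      exact: measurableT_comp.
    by move=> z; rewrite normr_id.
  by apply: (@integrable_unit_square (cst M) `|M|).
by rewrite Rintegral_cst// [X in fine X]unit_square_measure mulr1.
Qed.

(** A class that contains the characters, is closed under linear combinations, and on which
    [integral_T2] is linear. *)
Definition bounded_measurable f := [/\ measurable_fun setT (fun z => complex.Re (f z)),
  measurable_fun setT (fun z => complex.Im (f z)) & exists M : R, forall z, nrm (f z) <= M].

Lemma bounded_measurable_e m : bounded_measurable (e_ m).
Proof.
have mp : measurable_fun setT (fun z : R * R => 2 * pi * (m.1%:~R * z.1 + m.2%:~R * z.2)).
  apply: measurable_funM => //; apply: measurable_funD; apply: measurable_funM => //.
split; rewrite /e_ /=.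
- by apply: (measurableT_comp _ mp); exact: (continuous_measurable_fun (@continuous_cos R)).
- by apply: (measurableT_comp _ mp); exact: (continuous_measurable_fun (@continuous_sin R)).
- by exists 1 => z; rewrite nrm_e.
Qed.

Lemma bounded_measurableD f g : bounded_measurable f -> bounded_measurable g ->
  bounded_measurable (fun z => f z + g z).
Proof.
move=> [f1 f2 [M fM]] [g1 g2 [M' gM]]; split.
- rewrite (_ : (fun z => _) = (fun z => complex.Re (f z) + complex.Re (g z))).
    exact: measurable_funD.
  by apply/funext => z; case: (f z) (g z) => ? ? [].
- rewrite (_ : (fun z => _) = (fun z => complex.Im (f z) + complex.Im (g z))).
    exact: measurable_funD.
  by apply/funext => z; case: (f z) (g z) => ? ? [].
- by exists (M + M') => z; apply: (le_trans (nrmD _ _)); exact: lerD.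
Qed.

Lemma bounded_measurableZ (c : R[i]) f : bounded_measurable f ->
  bounded_measurable (fun z => c * f z).
Proof.
move=> [f1 f2 [M fM]]; case: c => a b; split.
- rewrite (_ : (fun z => _) = (fun z => a * complex.Re (f z) - b * complex.Im (f z))).
    by apply: measurable_funB; apply: measurable_funM.
  by apply/funext => z; case: (f z).
- rewrite (_ : (fun z => _) = (fun z => a * complex.Im (f z) + b * complex.Re (f z))).
    by apply: measurable_funD; apply: measurable_funM.
  by apply/funext => z; case: (f z).
- exists (nrm (a +i* b) * M) => z; rewrite nrmM ler_wpM2l//; exact: nrm_ge0.
Qed.

Let iRe f : bounded_measurable f ->
  (mu \x mu)%E.-integrable (I `*` I) (EFin \o (fun z => complex.Re (f z))).
Proof.
move=> [mf _ [M fM]]; apply: (@integrable_unit_square _ M) => // z.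
exact: le_trans (Re_le_nrm _) (fM z).
Qed.

Let iIm f : bounded_measurable f ->
  (mu \x mu)%E.-integrable (I `*` I) (EFin \o (fun z => complex.Im (f z))).
Proof.
move=> [_ mf [M fM]]; apply: (@integrable_unit_square _ M) => // z.
exact: le_trans (Im_le_nrm _) (fM z).
Qed.

Lemma integral_T2D f g : bounded_measurable f -> bounded_measurable g ->
  integral_T2 (fun z => f z + g z) = integral_T2 f + integral_T2 g.
Proof.
move=> nf ng; have mI := measurable_unit_square.
rewrite /integral_T2; apply/eqP; rewrite eq_complex /=; apply/andP; split; apply/eqP.
- rewrite -RintegralD//; [|exact: iRe|exact: iRe].
  by apply: eq_Rintegral => z _; case: (f z) (g z) => ? ? [].
- rewrite -RintegralD//; [|exact: iIm|exact: iIm].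
  by apply: eq_Rintegral => z _; case: (f z) (g z) => ? ? [].
Qed.

Lemma integral_T2Z (c : R[i]) f : bounded_measurable f ->
  integral_T2 (fun z => c * f z) = c * integral_T2 f.
Proof.
move=> nf; have mI := measurable_unit_square.
case: c => a b.
have iZ (c : R) (h : R * R -> R) :
    (mu \x mu)%E.-integrable (I `*` I) (EFin \o h) ->
    (mu \x mu)%E.-integrable (I `*` I) (EFin \o (fun z => c * h z)).
  by move=> ih; exact: integrableZl ih.
rewrite /integral_T2; apply/eqP; rewrite eq_complex /=; apply/andP; split; apply/eqP.
- rewrite -!RintegralZl//; [|exact: iIm|exact: iRe].
  rewrite -RintegralB//; [|exact/iZ/iRe|exact/iZ/iIm].
  by apply: eq_Rintegral => z _; case: (f z).
- rewrite -!RintegralZl//; [|exact: iRe|exact: iIm].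
  rewrite -RintegralD//; [|exact/iZ/iIm|exact/iZ/iRe].
  by apply: eq_Rintegral => z _; case: (f z).
Qed.

(** Real and imaginary parts are bounded separately, whence the factor 2, which is harmless in all
    later estimates. *)
Lemma nrm_integral_T2 f (M : R) : bounded_measurable f -> (forall z, nrm (f z) <= M) ->
  nrm (integral_T2 f) <= M *+ 2.
Proof.
move=> [m1 m2 _] fM; apply: (le_trans (nrm_le _)); rewrite mulr2n /=.
apply: lerD; apply: Rintegral_prod_bnd => // z.
- exact: le_trans (Re_le_nrm _) (fM z).
- exact: le_trans (Im_le_nrm _) (fM z).
Qed.

(** Orthogonality of the characters: the addition formulas for cosine and sine reduce both parts to
    products of one-variable integrals. *)
Lemma integral_T2_e m : @integral_T2 R (e_ m) = (m == 0)%:R.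
Proof.
have c1 j (x : R) : `|cos (tp j * x)| <= 1 by rewrite ler_norml cos_geN1 cos_le1.
have s1 j (x : R) : `|sin (tp j * x)| <= 1 by rewrite ler_norml sin_geN1 sin_le1.
have cc j := @continuous_cosM (tp j).
have cs j := @continuous_sinM (tp j).
have mI := measurable_unit_square.
have iP (g h : R -> R) : continuous g -> continuous h ->
    (forall x : R, `|g x| <= 1) -> (forall x : R, `|h x| <= 1) ->
    (mu \x mu)%E.-integrable (I `*` I) (EFin \o (fun z => g z.1 * h z.2)).
  move=> cg ch bg bh; apply: (@integrable_unit_square _ 1).
    apply: measurable_funM.
      by apply: measurableT_comp => //; exact: continuous_measurable_fun.
    by apply: measurableT_comp => //; exact: continuous_measurable_fun.
  by move=> z; rewrite normrM mulr_ile1.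
rewrite /integral_T2 /e_ /=.
have E z : 2 * pi * (m.1%:~R * z.1 + m.2%:~R * z.2) = tp m.1 * z.1 + tp m.2 * z.2.
  by rewrite /tp; ring.
under eq_Rintegral do rewrite E cosD.
under [X in _ +i* X]eq_Rintegral do rewrite E sinD.
rewrite RintegralB//; [|exact: (iP _ _ (cc m.1) (cc m.2) (c1 _) (c1 _))
  |exact: (iP _ _ (cs m.1) (cs m.2) (s1 _) (s1 _))].
rewrite RintegralD//; [|exact: (iP _ _ (cs m.1) (cc m.2) (s1 _) (c1 _))
  |exact: (iP _ _ (cc m.1) (cs m.2) (c1 _) (s1 _))].
rewrite (Rintegral_prod (cc m.1) (cc m.2) (c1 _) (c1 _)).
rewrite (Rintegral_prod (cs m.1) (cs m.2) (s1 _) (s1 _)).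
rewrite (Rintegral_prod (cs m.1) (cc m.2) (s1 _) (c1 _)).
rewrite (Rintegral_prod (cc m.1) (cs m.2) (c1 _) (s1 _)).
rewrite !Rintegral_cos_tp !Rintegral_sin_tp.
rewrite !(mulr0, mul0r) subr0 addr0 -natrM mulnb.
by rewrite (_ : (m == 0) = (m.1 == 0) && (m.2 == 0))//; case: (_ && _).
Qed.

End integral.

(** * Absolutely convergent expansions *)

Section wiener.
Variable R : realType.
Implicit Types (m n : int * int) (z : R * R) (f g t : R * R -> R[i]).
Implicit Types (r : seq (R[i] * (int * int))) (S : set (int * int)) (B M : R).

(** Frequencies may recur in the list, so that sums and products of functions are concatenations and
    pairwise products of lists. *)
Definition expansion r z : R[i] := \sum_(x <- r) x.1 * e_ x.2 z.

(* [f] is supported in [S] with Wiener norm at most [B]; working with such bounds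
   rather than with a norm avoids any appeal to the uniqueness of expansions. *)
Definition wiener S B f := exists r,
  [/\ forall x, x \in r -> S x.2, \sum_(x <- r) nrm x.1 <= B & f =1 expansion r].

Lemma wiener_le S S' B B' f : S `<=` S' -> B <= B' -> wiener S B f -> wiener S' B' f.
Proof.
move=> SS' BB' [r [rS rB fr]]; exists r; split => //.
  by move=> x /rS /SS'.
exact: le_trans BB'.
Qed.

Lemma wiener_leB S B B' f : B <= B' -> wiener S B f -> wiener S B' f.
Proof. exact: wiener_le. Qed.

Lemma wiener_leS S S' B f : S `<=` S' -> wiener S B f -> wiener S' B f.
Proof. by move=> SS'; exact: wiener_le. Qed.

Lemma wiener_ge0 S B f : wiener S B f -> 0 <= B.
Proof.
by move=> [r [_ rB _]]; apply: le_trans rB; apply: sumr_ge0 => x _; exact: nrm_ge0.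
Qed.

Lemma nrm_wiener S B f z : wiener S B f -> nrm (f z) <= B.
Proof.
move=> [r [_ rB ->]]; apply: le_trans rB; apply: (le_trans (nrm_sum _ _ _)).
by apply: ler_sum => x _; rewrite nrmM nrm_e mulr1.
Qed.

Lemma wienerD S B B' f g : wiener S B f -> wiener S B' g ->
  wiener S (B + B') (fun z => f z + g z).
Proof.
move=> [r [rS rB fr]] [r' [r'S r'B gr']]; exists (r ++ r'); split.
- by move=> x; rewrite mem_cat => /orP[/rS|/r'S].
- by rewrite big_cat lerD.
- by move=> z; rewrite /expansion big_cat fr gr'.
Qed.

(** Characters multiply by adding frequencies, so the Wiener norm is submultiplicative. Three
    separate sets allow translates, and half-planes with different offsets, to be combined. *)
Lemma wienerM S S' S'' B B' f g : (forall m n, S m -> S' n -> S'' (m + n)) ->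
  wiener S B f -> wiener S' B' g -> wiener S'' (B * B') (fun z => f z * g z).
Proof.
move=> SS [r [rS rB fr]] [r' [r'S r'B gr']].
exists [seq (x.1 * y.1, x.2 + y.2) | x <- r, y <- r']; split.
- by move=> x /allpairsP[[u v] /= [/rS uS /r'S vS ->]] /=; exact: SS.
- rewrite big_allpairs_dep /= (eq_bigr (fun x => nrm x.1 * \sum_(y <- r') nrm y.1)).
    rewrite -mulr_suml ler_pM//; apply: sumr_ge0 => x _; exact: nrm_ge0.
  by move=> x _; rewrite mulr_sumr; apply: eq_bigr => y _; rewrite nrmM.
- move=> z; rewrite fr gr' /expansion big_allpairs_dep /= mulr_suml.
  apply: eq_bigr => x _; rewrite mulr_sumr; apply: eq_bigr => y _.
  by rewrite e_D mulrACA.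
Qed.

Lemma wiener_e S m : S m -> wiener S 1 (e_ m).
Proof.
move=> Sm; exists [:: (1, m)]; split.
- by move=> x; rewrite inE => /eqP ->.
- by rewrite big_seq1 nrm1.
- by move=> z; rewrite /expansion big_seq1 mul1r.
Qed.

Lemma wiener_cst S (c : R[i]) : S 0 -> wiener S (nrm c) (fun=> c).
Proof.
move=> S0; exists [:: (c, 0)]; split.
- by move=> x; rewrite inE => /eqP ->.
- by rewrite big_seq1.
- by move=> z; rewrite /expansion big_seq1 e_0 mulr1.
Qed.

Lemma wienerZ S B f (c : R[i]) : wiener S B f ->
  wiener S (nrm c * B) (fun z => c * f z).
Proof.
apply: (@wienerM [set 0]); last exact: wiener_cst.
by move=> m n -> /=; rewrite add0r.
Qed.

Lemma wienerN S B f : wiener S B f -> wiener S B (fun z => - f z).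
Proof.
move=> /(wienerZ (-1)); rewrite nrmN nrm1 mul1r.
by under eq_fun do rewrite mulN1r.
Qed.

Lemma wienerJ S B f : wiener S B f -> wiener [set m | S (- m)] B (fun z => (f z)^*).
Proof.
move=> [r [rS rB fr]]; exists [seq (x.1^*, - x.2) | x <- r]; split.
- by move=> x /mapP[y /rS yS ->] /=; rewrite opprK.
- by rewrite big_map /=; under eq_bigr do rewrite nrmJ.
- move=> z; rewrite fr /expansion big_map rmorph_sum /=.
  by apply: eq_bigr => x _; rewrite rmorphM /= e_N.
Qed.

Lemma wiener_sum S (I : Type) (s : seq I) (P : pred I) (b : I -> R)
    (F : I -> R * R -> R[i]) : (forall i, P i -> wiener S (b i) (F i)) ->
  wiener S (\sum_(i <- s | P i) b i) (fun z => \sum_(i <- s | P i) F i z).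
Proof.
move=> FS; elim: s => [|i s IH].
  exists [::]; split => //; rewrite ?big_nil//.
  by move=> z; rewrite /expansion !big_nil.
rewrite big_cons; case: ifPn => Pi; [have := wienerD (FS i Pi) IH|have := IH];
  by congr wiener; apply/funext => z; rewrite big_cons ?Pi ?(negbTE Pi).
Qed.

(** Cutting the list in two cuts the sum of moduli in two. The supremum norm has no such property:
    restricting frequencies to a half-plane is unbounded for it. *)
Lemma wiener_split (p : pred (int * int)) S B f : wiener S B f -> exists f1 f2 B1 B2,
  [/\ wiener [set m | S m /\ p m] B1 f1, wiener [set m | S m /\ ~~ p m] B2 f2,
  B1 + B2 <= B & forall z, f z = f1 z + f2 z].
Proof.
move=> [r [rS rB fr]].
have sumF (V : nmodType) (F : R[i] * (int * int) -> V) : \sum_(x <- r) F x =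
    \sum_(x <- [seq x <- r | p x.2]) F x + \sum_(x <- [seq x <- r | ~~ p x.2]) F x.
  by rewrite !big_filter (bigID (fun x => p x.2)).
exists (expansion [seq x <- r | p x.2]), (expansion [seq x <- r | ~~ p x.2]).
do 2 eexists; split.
- eexists; split; [|exact: lexx|by []].
  by move=> x; rewrite mem_filter => /andP[px /rS].
- eexists; split; [|exact: lexx|by []].
  by move=> x; rewrite mem_filter => /andP[px /rS].
- by rewrite -sumF.
- by move=> z; rewrite fr /expansion sumF.
Qed.

(** * Fourier coefficients of expansions *)

Lemma bounded_measurable_expansion r : bounded_measurable (expansion r).
Proof.
elim: r => [|x r IH].
  have := bounded_measurableZ 0 (@bounded_measurable_e R 0).
  by congr bounded_measurable; apply/funext => z; rewrite mul0r /expansion big_nil.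
have := bounded_measurableD (bounded_measurableZ x.1 (bounded_measurable_e _ x.2)) IH.
by congr bounded_measurable; apply/funext => z; rewrite /expansion big_cons.
Qed.

Lemma integral_T2_expansion r :
  integral_T2 (expansion r) = \sum_(x <- r | x.2 == 0) x.1.
Proof.
elim: r => [|x r IH].
  rewrite big_nil -(mul0r (integral_T2 (e_ 0))) -integral_T2Z.
    by congr integral_T2; apply/funext => z; rewrite mul0r /expansion big_nil.
  exact: bounded_measurable_e.
rewrite big_cons -IH; have ne := bounded_measurable_e R x.2.
transitivity (x.1 * integral_T2 (e_ x.2) + integral_T2 (expansion r)).
  rewrite -integral_T2Z// -integral_T2D; [|exact: bounded_measurableZ
    |exact: bounded_measurable_expansion].
  by congr integral_T2; apply/funext => z; rewrite /expansion big_cons.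
by rewrite integral_T2_e; case: eqP => _; rewrite ?mulr1// mulr0 add0r.
Qed.

Let shift m r := [seq (x.1, x.2 - m) | x <- r].

Let shiftE m r z : expansion r z * (e_ m z)^* = expansion (shift m r) z.
Proof.
rewrite /expansion mulr_suml big_map; apply: eq_bigr => x _ /=.
by rewrite e_D e_N mulrA.
Qed.

Lemma fourier_coef_expansion r m :
  fourier_coef (expansion r) m = \sum_(x <- r | x.2 == m) x.1.
Proof.
rewrite /fourier_coef; under eq_fun do rewrite shiftE.
rewrite integral_T2_expansion big_map /=; apply: eq_bigl => x /=.
by rewrite subr_eq0.
Qed.

Lemma nrm_fourier_coef r m M : (forall z, nrm (expansion r z) <= M) ->
  nrm (fourier_coef (expansion r) m) <= M *+ 2.
Proof.
move=> rM; apply: nrm_integral_T2 => [|z].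
  by under eq_fun do rewrite shiftE; exact: bounded_measurable_expansion.
by rewrite nrmM nrmJ nrm_e mulr1.
Qed.

Lemma expansion_by_freq r z : expansion r z =
  \sum_(m <- undup (map snd r)) (\sum_(x <- r | x.2 == m) x.1) * e_ m z.
Proof.
under eq_bigr do rewrite mulr_suml.
rewrite (exchange_big_dep predT) //= /expansion big_seq [RHS]big_seq.
apply: eq_bigr => x xr; rewrite -big_filter (eq_filter (a2 := pred1 x.2)).
  by rewrite filter_pred1_uniq ?big_seq1 ?undup_uniq// mem_undup; apply/mapP; exists x.
by move=> m /=; rewrite eq_sym.
Qed.

Lemma trig_polyP t : trig_poly t <-> exists r, t = expansion r.
Proof.
split=> [[s [c tE]]|[r ->]].
  exists [seq (c m, m) | m <- s]; apply/funext => z.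
  by rewrite tE /expansion big_map.
exists (undup (map snd r)), (fun m => \sum_(x <- r | x.2 == m) x.1) => z.
exact: expansion_by_freq.
Qed.

(** The list on the right has each frequency once, and only frequencies in [freq]: this turns
    conditions on [freq] into supports, and bounds on coefficients into Wiener bounds. *)
Lemma fourier_inversion r z : expansion r z =
  expansion [seq (fourier_coef (expansion r) m, m) |
    m <- undup (map snd r) & fourier_coef (expansion r) m != 0] z.
Proof.
rewrite expansion_by_freq [RHS]/expansion big_map big_filter /= [RHS]big_mkcond /=.
apply: eq_bigr => m _; rewrite -fourier_coef_expansion.
by case: ifPn => // /negbNE /eqP ->; rewrite mul0r.
Qed.

Lemma freq_wiener S B f : wiener S B f -> freq f `<=` S.
Proof.
move=> [r [rS _ /funext ->]] m; rewrite /freq /= fourier_coef_expansion => nz.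
apply: contrapT => Sm; move/negP: nz; apply; apply/eqP.
rewrite big_seq_cond big1// => x /andP[/rS xS /eqP xm]; by case: Sm; rewrite -xm.
Qed.

Lemma wiener_trig_poly S B f : wiener S B f -> trig_poly f.
Proof. by move=> [r [_ _ /funext fr]]; apply/trig_polyP; exists r. Qed.

Lemma trig_poly_wiener S t : trig_poly t -> freq t `<=` S -> exists B, wiener S B t.
Proof.
move=> /trig_polyP[r ->] rS; eexists; eexists; split; last exact: fourier_inversion.
  by move=> x /mapP[m + ->] /=; rewrite mem_filter => /andP[/rS].
exact: lexx.
Qed.

(** At most [size s] coefficients are nonzero, each at most twice the supremum: on a finite set of
    frequencies the supremum norm controls the Wiener norm. *)
Lemma wiener_sup S B f (s : seq (int * int)) M : wiener S B f ->
  (forall m, S m -> m \in s) -> (forall z, nrm (f z) <= M) ->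
  wiener S (M *+ 2 *+ size s) f.
Proof.
move=> [r [rS _ /funext ->]] Ss rM; eexists; split; last exact: fourier_inversion.
  by move=> x /mapP[m + ->] /=; rewrite mem_filter mem_undup => /andP[_ /mapP[y /rS yS ->]].
have M0 : 0 <= M by apply: le_trans (rM 0); exact: nrm_ge0.
rewrite big_map big_filter /=; apply: (@le_trans _ _ (\sum_(m <- undup (map snd r)) M *+ 2)).
  rewrite big_mkcond; apply: ler_sum => m _; case: ifP => _.
    exact: nrm_fourier_coef.
  by rewrite mulrn_wge0.
rewrite big_const_seq count_predT iter_addr_0 ler_wpMn2l ?mulrn_wge0//.
apply: uniq_leq_size; first exact: undup_uniq.
by move=> m; rewrite mem_undup => /mapP[y /rS yS ->]; exact: Ss.
Qed.

End wiener.

(** * Truncated exponential and logarithm *)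

Section truncated.
Variable F : numFieldType.

Definition expS (K : nat) (x : F) : F := \sum_(i < K.+1) x ^+ i / i`!%:R.

(** Truncation of the series of - log (1 - x). *)
Definition logS (N : nat) (x : F) : F := \sum_(1 <= n < N.+1) x ^+ n / n%:R.

(** By the binomial formula the terms with i + j <= K form [expS K (x + y)]. The rest is a
    polynomial with nonnegative coefficients, on which [wiener_expSM] relies. *)
Lemma expSM K x y : expS K x * expS K y = expS K (x + y) +
  \sum_(i < K.+1) \sum_(j < K.+1 | (K < i + j)%N) x ^+ i / i`!%:R * (y ^+ j / j`!%:R).
Proof.
pose a (i j : nat) := x ^+ i / i`!%:R * (y ^+ j / j`!%:R).
have -> : expS K (x + y) = \sum_(i < K.+1) \sum_(j < K.+1 | (i + j <= K)%N) a i j.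
  (* Regroup by the total degree n = i + j. *)
  transitivity (\sum_(n < K.+1) \sum_(i < K.+1 | (i <= n)%N) a i (n - i)%N).
    apply: eq_bigr => n _; rewrite addrC exprDn mulr_suml.
    rewrite (big_ord_widen K.+1 (fun i => (y ^+ (n - i) * x ^+ i *+ 'C(n, i)) / n`!%:R))//.
    apply: eq_bigr => i; rewrite ltnS => ni; rewrite /a.
    have nf k : (k`!%:R : F) != 0 by rewrite pnatr_eq0 -lt0n fact_gt0.
    rewrite -(bin_fact ni) !natrM -mulr_natr.
    have nC : ('C(n, i)%:R : F) != 0 by rewrite pnatr_eq0 -lt0n bin_gt0.
    by field; rewrite nC !nf.
  rewrite (exchange_big_dep predT) //=; apply: eq_bigr => i _.
  have iK : (i <= K)%N by rewrite -ltnS.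
  rewrite -(big_mkord (fun n => (i <= n)%N) (fun n => a i (n - i)%N)).
  rewrite -(big_mkord (fun j => (i + j <= K)%N) (fun j => a i j)).
  rewrite (big_cat_nat (n := i)) //=; last exact: leqW.
  rewrite big_nat_cond big_pred0 ?add0r; last by move=> n; case: (ltnP n i); rewrite ?andbF ?andbT.
  rewrite -{1}[i : nat]add0n big_addn.
  rewrite (big_nat_widen 0 (K.+1 - i) K.+1) ?leq_subr//.
  apply: eq_big => [j|j _]; last by rewrite addnK.
  by rewrite leq_addl /= ltn_subRL addnC ltnS addnC.
rewrite -big_split /= /expS mulr_suml; apply: eq_bigr => i _.
rewrite mulr_sumr (bigID (fun j : 'I_K.+1 => (i + j <= K)%N)) /=; congr (_ + _).
by apply: eq_bigl => j; rewrite -ltnNge.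
Qed.

Lemma expS0 K : expS K 0 = 1.
Proof.
rewrite /expS big_ord_recl /= expr0 fact0 divr1 big1 ?addr0// => i _.
by rewrite exprS mul0r mul0r.
Qed.

(** * The exponential of the truncated logarithm *)

Let L N : {poly F} := \sum_(1 <= n < N.+1) n%:R^-1 *: 'X^n.
(** Truncated form of exp (- log (1 - X)) = 1 / (1 - X), a series whose coefficients are all 1. *)
Let H N K : {poly F} := \sum_(i < K.+1) i`!%:R^-1 *: L N ^+ i.

Let L_horner N x : (L N).[x] = logS N x.
Proof.
rewrite /L horner_sum; apply: eq_bigr => n _.
by rewrite hornerZ hornerXn mulrC.
Qed.

Let H_horner N K x : (H N K).[x] = expS K (logS N x).
Proof.
rewrite /H horner_sum; apply: eq_bigr => n _.
by rewrite hornerZ horner_exp L_horner mulrC.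
Qed.

Let L_deriv N : (L N)^`() = \sum_(i < N) 'X^i.
Proof.
rewrite /L raddf_sum /= big_add1 /= big_mkord; apply: eq_bigr => i _.
rewrite derivZ derivXn -[X in _ *: X]scaler_nat scalerA mulVf ?scale1r//.
Qed.

Let H_deriv N K : (H N K.+1)^`() = H N K * (L N)^`().
Proof.
rewrite /H big_ord_recl /= derivD expr0 derivZ derivC scaler0 add0r.
rewrite raddf_sum mulr_suml /=; apply: eq_bigr => i _.
rewrite derivZ /bump /= add1n deriv_exp /= -[X in _ *: X]scaler_nat scalerA -scalerAl.
congr (_ *: _); last by rewrite mulrC.
rewrite factS natrM invfM mulrAC mulVf ?mul1r//.
Qed.

Let H0 N K : (H N K)`_0 = 1.
Proof.
rewrite -horner_coef0 H_horner (_ : logS N 0 = 0) ?expS0//.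
rewrite /logS big_add1 /= big1// => i _.
by rewrite exprS mul0r mul0r.
Qed.

Let coef_geom N k : (\sum_(i < N) 'X^i : {poly F})`_k = (k < N)%:R.
Proof.
rewrite (_ : \sum_(i < N) 'X^i = \poly_(i < N) 1) ?coef_poly; first by case: ltnP.
by rewrite poly_def; apply: eq_bigr => i _; rewrite scale1r.
Qed.

(* By induction on K, since H_{K+1}' = H_K * (1 + X + ... + X^{N-1}). *)
Let H_coef N K k : [/\ 0 <= (H N K)`_k, (H N K)`_k <= 1 &
  ((k <= K)%N && (k <= N)%N -> (H N K)`_k = 1)].
Proof.
elim: K k => [|K IH] k.
  rewrite /H big_ord1 expr0 fact0 invr1 scale1r coef1.
  by case: k => [|k] /=; split; rewrite ?ler01 ?lexx.
case: k => [|k]; first by rewrite H0; split; rewrite ?ler01 ?lexx.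
(* Thus [k.+1] times the new coefficient is a sum of [k.+1] terms in [0, 1], all equal to 1 when k
   <= K and k < N. *)
have E : (H N K.+1)`_k.+1 *+ k.+1 = \sum_(j < k.+1) (H N K)`_(k - j) * (j < N)%:R.
  rewrite -coef_deriv H_deriv coefMr L_deriv.
  by apply: eq_bigr => j _; rewrite coef_geom.
have k0 : 0 < (k.+1%:R : F) by rewrite ltr0n.
have c1 : (1 : F) *+ k.+1 = \sum_(j < k.+1) 1 by rewrite sumr_const card_ord.
split.
- rewrite -(pmulrn_lge0 _ (ltn0Sn k)) E; apply: sumr_ge0 => j _.
  by apply: mulr_ge0; [case: (IH (k - j)%N)|exact: ler0n].
- rewrite -(ler_pMn2r (ltn0Sn k)) E c1.
  apply: ler_sum => j _; case: (IH (k - j)%N) => h0 h1 _.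
  by rewrite mulr_ile1// ?ler0n// lern1 leq_b1.
- move=> /andP[kK kN]; apply: (mulIf (lt0r_neq0 k0)).
  rewrite mul1r mulr_natr E c1.
  apply: eq_bigr => j _; case: (IH (k - j)%N) => _ _ ->; last first.
    by rewrite !(leq_trans (leq_subr _ _))// ltnW.
  by rewrite mul1r (leq_trans (ltn_ord j)).
Qed.

(** The coefficients of (1 - X) [H] in positive degree are differences of consecutive coefficients
    of [H]. They vanish in degrees 1 to [N], where those coefficients are 1, and elsewhere have
    modulus at most 1. *)
Lemma expS_logS N K : (N <= K)%N -> exists (c : nat -> F) (n : nat),
  (forall k, `|c k| <= 1) /\
  forall x, (1 - x) * expS K (logS N x) = 1 + \sum_(N.+1 <= k < n) c k * x ^+ k.
Proof.
move=> NK; pose G : {poly F} := (1 - 'X) * H N K - 1.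
have GS k : G`_k.+1 = (H N K)`_k.+1 - (H N K)`_k.
  by rewrite /G coefB mulrBl mul1r coefB coefXM coef1 /= subr0.
have G0 : G`_0 = 0.
  by rewrite /G coefB mulrBl mul1r coefB coefXM coef1 /= H0 subr0 subrr.
exists (fun k => G`_k), (maxn N.+1 (size G)); split.
  case=> [|k]; first by rewrite G0 normr0.
  have [a0 a1 _] := H_coef N K k; have [b0 b1 _] := H_coef N K k.+1.
  rewrite GS real_ler_norml ?rpredB ?ger0_real//.
  apply/andP; split; first by rewrite lerBrDr (le_trans _ b0)// addrC subr_le0.
  by rewrite lerBlDr (le_trans b1) ?lerDl.
move=> x; transitivity (1 + G.[x]).
  rewrite /G hornerD hornerM !hornerE H_horner /=.
  by rewrite [RHS]addrC addKr.
congr (_ + _); rewrite horner_coef.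
rewrite (big_ord_widen (maxn N.+1 (size G)) (fun i => G`_i * x ^+ i)) ?leq_maxr//.
rewrite big_mkcond /= -(big_mkord xpredT (fun i => if (i < size G)%N then G`_i * x ^+ i else 0)).
rewrite (big_cat_nat (n := N.+1)) ?leq_maxl//= big_nat big1 ?add0r => [|[|k]].
- apply: eq_bigr => k _; case: ltnP => // kG.
  by rewrite nth_default// mul0r.
- by rewrite G0 mul0r if_same.
- move=> /= kN; have {}kN : (k < N)%N by [].
  rewrite GS; case: (H_coef N K k) => _ _ ->; last first.
    by rewrite !(leq_trans (ltnW kN)).
  case: (H_coef N K k.+1) => _ _ ->; first by rewrite subrr mul0r if_same.
  by rewrite (leq_trans kN) // kN.
Qed.

End truncated.

(** * Estimates in the Wiener algebra *)

Section bounds.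
Variable R : realType.
Implicit Types (m n : int * int) (z : R * R) (f g t : R * R -> R[i]).
Implicit Types (S : set (int * int)) (B M : R).

Lemma expS_series K B : expS K B = series (exp_coeff B) K.+1.
Proof. by rewrite /series /= big_mkord. Qed.

Lemma expS_cvg B : expS K B @[K --> \oo] --> expR B.
Proof.
rewrite (_ : (fun K => expS K B) = [sequence series (exp_coeff B) n.+1]_n).
  rewrite cvg_shiftS; exact: is_cvg_series_exp_coeff.
by apply/funext => K; exact: expS_series.
Qed.

Lemma expS_le_expR K B : 0 <= B -> expS K B <= expR B.
Proof.
move=> B0; rewrite expS_series; apply: nondecreasing_cvgn_le.
  by apply: nondecreasing_series => n _ _; exact: exp_coeff_ge0.
exact: is_cvg_series_exp_coeff.
Qed.

(** Both terms tend to exp (2 B). This makes the bound of [wiener_expSM] small, uniformly over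
    functions of norm at most [B]. *)
Lemma expS_defect B (e : R) : 0 < e -> exists K0, forall K, (K0 <= K)%N ->
  expS K B * expS K B - expS K (B + B) <= e.
Proof.
move=> e0.
have : (expS K B * expS K B - expS K (B + B)) @[K --> \oo] --> (0 : R).
  rewrite -(subrr (expR (B + B))) {1}expRD.
  by apply: cvgB; [apply: cvgM|]; exact: expS_cvg.
move=> /cvgrPdist_le /(_ e e0)[K0 _ H]; exists K0 => K KK.
by have := H K KK; rewrite sub0r normrN; apply: le_trans; exact: ler_norm.
Qed.

Lemma wienerX S B f k : S 0 -> (forall m n, S m -> S n -> S (m + n)) ->
  wiener S B f -> wiener S (B ^+ k) (fun z => f z ^+ k).
Proof.
move=> S0 SD fS; elim: k => [|k IH].
  by rewrite expr0 -(nrm1 R); exact: wiener_cst.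
by rewrite exprS; under eq_fun do rewrite exprS; exact: (wienerM SD fS IH).
Qed.

Lemma nrm_natV k : nrm (k%:R^-1 : R[i]) = k%:R^-1.
Proof.
apply/complexI; rewrite nrmE normfV normr_nat. rewrite fmorphV.
by congr (_^-1); rewrite rmorph_nat.
Qed.

Lemma wiener_expS S B f K : S 0 -> (forall m n, S m -> S n -> S (m + n)) ->
  wiener S B f -> wiener S (expS K B) (fun z => expS K (f z)).
Proof.
move=> S0 SD fS; apply: wiener_sum => i _.
rewrite mulrC -nrm_natV; under eq_fun do rewrite mulrC.
by apply: wienerZ; exact: wienerX.
Qed.

(** The remainder in [expSM] has nonnegative coefficients, so its value at (B, B) bounds its Wiener
    norm at (f, g). *)
Lemma wiener_expSM B f g K : wiener setT B f -> wiener setT B g ->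
  wiener setT (expS K B * expS K B - expS K (B + B))
    (fun z => expS K (f z) * expS K (g z) - expS K (f z + g z)).
Proof.
move=> fB gB; rewrite expSM addrAC subrr add0r.
rewrite (_ : (fun z => _) = fun z => \sum_(i < K.+1) \sum_(j < K.+1 | (K < i + j)%N)
  f z ^+ i / i`!%:R * (g z ^+ j / j`!%:R)); last first.
  by apply/funext => z; rewrite expSM addrAC subrr add0r.
have H h k : wiener setT B h ->
    wiener setT (B ^+ k / k`!%:R) (fun z => h z ^+ k / k`!%:R).
  move=> hB; rewrite mulrC -nrm_natV; under eq_fun do rewrite mulrC.
  by apply: wienerZ; exact: wienerX.
apply: wiener_sum => i _; apply: wiener_sum => j _.
by apply: (@wienerM _ setT setT setT _ _ _ _ _ (H _ _ fB) (H _ _ gB)).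
Qed.

Lemma wiener_logS (nu : nat -> R) f N : (forall k, wiener setT (nu k) (fun z => f z ^+ k)) ->
  wiener setT (\sum_(1 <= k < N.+1) nu k) (fun z => logS N (f z)).
Proof.
move=> fnu; apply: (@wiener_le _ setT _ (\sum_(1 <= k < N.+1) k%:R^-1 * nu k)) => //.
  apply: ler_sum_nat => k /andP[k0 _]; rewrite ler_piMl ?(wiener_ge0 (fnu k))//.
  by rewrite invf_le1 ?ler1n ?ltr0n.
apply: wiener_sum => k _; rewrite -nrm_natV; under eq_fun do rewrite mulrC.
exact: wienerZ.
Qed.

(** * Powers and the spectral radius *)

Definition box (d : nat) : set (int * int) :=
  [set m | (`|m.1|%N <= d)%N && (`|m.2|%N <= d)%N].

Definition seq_box (d : nat) : seq (int * int) :=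
  let s := [seq (i%:Z - d%:Z) | i <- iota 0 (d.*2.+1)] in [seq (i, j) | i <- s, j <- s].

Lemma seq_boxP d m : box d m -> m \in seq_box d.
Proof.
have H (j : int) : (`|j|%N <= d)%N -> j \in [seq (i%:Z - d%:Z) | i <- iota 0 (d.*2.+1)].
  move=> jd; apply/mapP; exists (absz (j + d%:Z)%R); last by lia.
  by rewrite mem_iota; lia.
move=> /andP[/H h1 /H h2]; apply/allpairsP; exists m; split => //.
by case: m {h1 h2}.
Qed.

Lemma size_seq_box d : size (seq_box d) = (d.*2.+1 ^ 2)%N.
Proof. by rewrite size_allpairs size_map size_iota. Qed.

Lemma wiener_box S B f : wiener S B f -> exists d, wiener (box d) B f.
Proof.
move=> [r [_ rB fr]].
exists (\max_(x <- r) maxn `|x.2.1| `|x.2.2|)%N, r; split => //.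
move=> x xr; rewrite /box /= -geq_max.
exact: (@leq_bigmax_seq _ r xpredT (fun x => maxn `|x.2.1|%N `|x.2.2|%N) x xr isT).
Qed.

Lemma wienerX_box d B f k : wiener (box d) B f ->
  wiener (box (k * d)) (B ^+ k) (fun z => f z ^+ k).
Proof.
move=> fd; elim: k => [|k IH].
  by rewrite expr0 -(nrm1 R); exact: wiener_cst.
rewrite exprS; under eq_fun do rewrite exprS; apply: (wienerM _ fd IH).
move=> m n /andP[m1 m2] /andP[n1 n2]; rewrite /box /= mulSn.
by apply/andP; split; lia.
Qed.

(* The spectral radius in the Wiener algebra is at most the supremum norm. *)
Lemma wiener_pow_geometric S B f (rho : R) : wiener S B f -> rho < 1 ->
  (forall z, nrm (f z) <= rho) -> exists C sigma : R, [/\ 0 <= C, 0 <= sigma, sigma < 1 &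
    forall k, wiener setT (C * sigma ^+ k) (fun z => f z ^+ k)].
Proof.
move=> /wiener_box[d fd] rho1 frho.
have rho0 : 0 <= rho by apply: le_trans (frho 0); exact: nrm_ge0.
(* This [h] keeps (1 + h)^2 rho below 1, and [c] is such that 2 k d + 1 <= c (1 + h)^k. The square
   of the latter counts the frequencies of f^k. *)
pose h := (1 - rho) / 4; have h0 : 0 < h by rewrite /h; lra.
pose c := 1 + d.*2%:R / h.
have c0 : 0 <= c by rewrite /c addr_ge0// divr_ge0// ltW.
exists (c ^+ 2 *+ 2), ((1 + h) ^+ 2 * rho); split.
- by rewrite mulrn_wge0// exprn_ge0.
- by rewrite mulr_ge0// exprn_ge0//; lra.
- have -> : rho = 1 - 4 * h by rewrite /h; field.
  by have : h < 1 by [rewrite /h; lra]; nra.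
move=> k; apply: wiener_le (wiener_sup (M := rho ^+ k) (wienerX_box k fd) (@seq_boxP _) _) => //.
  rewrite size_seq_box.
  have -> : c ^+ 2 *+ 2 * ((1 + h) ^+ 2 * rho) ^+ k = rho ^+ k *+ 2 * (c * (1 + h) ^+ k) ^+ 2.
    by rewrite exprMn -exprM mulnC exprM; ring.
  rewrite -[leLHS]mulr_natr ler_wpM2l ?mulrn_wge0 ?exprn_ge0//.
  rewrite natrX lerXn2r ?nnegrE ?mulr_ge0 ?exprn_ge0//; first by lra.
  have bern : 1 + h *+ k <= (1 + h) ^+ k.
    elim: k => [|k IH]; first by rewrite mulr0n addr0 expr0.
    rewrite exprS; apply: (@le_trans _ _ ((1 + h) * (1 + h *+ k))); last first.
      by rewrite ler_wpM2l//; lra.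
    by have : 0 <= h *+ k by [rewrite mulrn_wge0// ltW]; rewrite mulrS; nra.
  apply: (@le_trans _ _ (c * (1 + h *+ k))); last by rewrite ler_wpM2l.
  have -> : ((k * d).*2.+1)%:R = 1 + d.*2%:R * k%:R :> R.
    by rewrite -addn1 -muln2 -[d.*2]muln2 !natrD !natrM; ring.
  rewrite /c -[h *+ k]mulr_natr; have k0 : 0 <= (k%:R : R) by [].
  have d0 : 0 <= (d.*2%:R : R) by [].
  have -> : (1 + d.*2%:R / h) * (1 + h * k%:R) =
    1 + d.*2%:R * k%:R + (h * k%:R + d.*2%:R / h) by field; rewrite gt_eqF.
  by rewrite lerDl; apply: addr_ge0; [apply: mulr_ge0|apply: divr_ge0] => //; exact: ltW.
by move=> z; rewrite nrmX lerXn2r ?nnegrE ?nrm_ge0.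
Qed.

Lemma geometric_sum_le (C sigma : R) (m n : nat) : 0 <= C -> 0 <= sigma -> sigma < 1 ->
  \sum_(m <= k < n) C * sigma ^+ k <= C * sigma ^+ m / (1 - sigma).
Proof.
move=> C0 s0 s1; have s1' : 0 < 1 - sigma by rewrite subr_gt0.
rewrite -mulr_sumr -mulrA ler_wpM2l// ler_pdivlMr//.
have [nm|/ltnW mn] := leqP n m.
  by rewrite big_geq// mul0r exprn_ge0.
rewrite mulr_suml (eq_bigr (fun k => - (sigma ^+ k.+1 - sigma ^+ k))); last first.
  by move=> k _; rewrite exprSr; ring.
rewrite sumrN telescope_sumr// opprB gerBl; exact: exprn_ge0.
Qed.
End bounds.

(** * Spectral factorization *)

Section factorization.
Variable R : realType.
Implicit Types (m n : int * int) (z : R * R) (f g t : R * R -> R[i]).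
Implicit Types (S : set (int * int)) (B M : R).

Lemma expSJ K (x : R[i]) : (expS K x)^* = expS K x^*.
Proof.
rewrite /expS rmorph_sum /=; apply: eq_bigr => i _.
by rewrite rmorphM /= fmorphV rmorph_nat rmorphXn.
Qed.

Lemma logSJ N (x : R[i]) : (logS N x)^* = logS N x^*.
Proof.
rewrite /logS rmorph_sum /=; apply: eq_bigr => i _.
by rewrite rmorphM /= fmorphV rmorph_nat rmorphXn.
Qed.

(** With [p] and [n] the parts of [f] in L >= 0 and L < 0, take for [b] the mean of [p] and the
    conjugate of [n]. Then b + conj b is the mean of [f] and its conjugate, and frequencies with L =
    0 need no separate treatment. *)
Lemma wiener_real_split (L : int * int -> R) B f : {morph L : m / - m} ->
  wiener setT B f -> (forall z, (f z)^* = f z) ->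
  exists2 b, wiener [set m | 0 <= L m] B b & forall z, f z = b z + (b z)^*.
Proof.
move=> LN fB fJ; have B0 := wiener_ge0 fB.
have [p [n [B1 [B2 [pB nB B12 fE]]]]] := wiener_split (fun m => 0 <= L m) fB.
have half : nrm (2^-1 : R[i]) = 2^-1 by rewrite (nrm_natV R 2).
exists (fun z => 2^-1 * (p z + (n z)^*)).
  apply: (@wiener_le _ [set m | 0 <= L m] _ (nrm (2^-1 : R[i]) * (B1 + B2))) => //.
    rewrite half; lra.
  apply: wienerZ; apply: wienerD; first by apply: wiener_leS pB => m [].
  apply: wiener_leS (wienerJ nB) => m [_] /=.
  by rewrite LN -ltNge oppr_lt0 => /ltW.
move=> z; rewrite rmorphM rmorphD /= conjCK fmorphV rmorph_nat.
have := fJ z; rewrite fE rmorphD /= => /(congr1 (fun x => x + (p z + n z))) E.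
apply: (mulfI (_ : 2 != 0 :> R[i])); first by rewrite pnatr_eq0.
by rewrite mulr2n mulrDl !mul1r -{}E; field.
Qed.

(** Truncations of exp (- b) and (1 - f) exp (conj b) are each supported on one side. They nearly
    agree in the Wiener norm, so their difference can be split at L = l and shared between them. *)
Lemma spectral_factorization (L : int * int -> R) l B f (rho e : R) :
    {morph L : m n / m + n} -> 0 <= l ->
    wiener [set m | `|L m| <= l] B f -> (forall z, (f z)^* = f z) ->
    rho < 1 -> (forall z, nrm (f z) <= rho) -> 0 < e ->
  exists q, [/\ exists B', wiener [set m | 0 <= L m] B' q,
    exists B', wiener [set m | L m <= l] B' q &
    forall z, nrm (q z * (q z)^* - (1 - f z)) <= e].
Proof.
move=> LD l0 fB fJ rho1 frho e0.
have L0 : L 0 = 0 by apply: (addrI (L 0)); rewrite -LD !addr0.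
have LN : {morph L : m / - m}.
  by move=> m; apply: (addrI (L m)); rewrite -LD !subrr.
have [C [sigma [C0 s0 s1 fpow]]] := wiener_pow_geometric fB rho1 frho.
have s1' : 0 < 1 - sigma by rewrite subr_gt0.
have B0 := wiener_ge0 fB.
(* [U] bounds the norm of the truncated logarithm for every [N], [E] that of its exponentials, and
   [V] that of 1 - f. If each truncation costs at most [eta], then [eta * T] bounds the discrepancy
   [Q - P] and [eta * W] the final error. *)
pose U := C / (1 - sigma); have U0 : 0 <= U by rewrite divr_ge0// ltW.
pose E := expR U; have E0 : 0 <= E by exact: expR_ge0.
pose V := 1 + B; have V0 : 0 <= V by rewrite addr_ge0.
pose T := E + 2 * (E * V); have T0 : 0 <= T by rewrite !(addr_ge0, mulr_ge0).
pose W := T * (2 * E + T) + V.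
have W0 : 0 < W by rewrite /W ltr_wpDl ?ltr_pwDl// !(addr_ge0, mulr_ge0).
pose eta := Num.min 1 (e / W).
have eta0 : 0 < eta by rewrite lt_min ltr01 divr_gt0.
have eta1 : eta <= 1 by rewrite ge_min lexx.
have etaW : eta * W <= e by rewrite -ler_pdivlMr// ge_min lexx orbT.
have [N tailN] : exists N, C * sigma ^+ N.+1 / (1 - sigma) <= eta.
  have : sigma ^+ n @[n --> \oo] --> (0 : R) by apply: cvg_expr; rewrite ger0_norm.
  have d0 : 0 < eta / (U + 1) by rewrite divr_gt0// ltr_wpDl.
  move=> /cvgrPdist_le /(_ _ d0)[N _ /(_ N.+1 (leqnSn N))] H; exists N.
  rewrite sub0r normrN ger0_norm ?exprn_ge0// ler_pdivlMr ?ltr_wpDl// in H.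
  apply: le_trans H; rewrite mulrAC mulrC ler_wpM2l ?exprn_ge0//.
  by rewrite lerDl.
have [K0 defK0] := expS_defect U eta0.
(* [K0] depends on [U] but not on [N]; taking K >= N meets the requirement of [expS_logS]. *)
pose K := maxn K0 N; have defK := defK0 K (leq_maxl _ _).
have [c [n [c1 logE]]] := expS_logS R[i] (leq_maxr K0 N : (N <= K)%N).
have uU : wiener setT U (fun z => logS N (f z)).
  apply: wiener_leB (wiener_logS N fpow).
  apply: (le_trans (geometric_sum_le _ _ C0 s0 s1)).
  by rewrite expr1 /U ler_wpM2r ?invr_ge0 ?(ltW s1')// ler_piMr// ltW.
have [b bU uE] : exists2 b, wiener [set m | 0 <= L m] U b &
    forall z, logS N (f z) = b z + (b z)^*.
  by apply: wiener_real_split LN uU _ => z; rewrite logSJ fJ.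
have EE : expS K U <= E by exact: expS_le_expR.
(* With exact series D1 = D2 = G = 0, hence Q = P. *)
pose Q z := expS K (- b z).
pose P z := (1 - f z) * expS K (b z)^*.
pose G z := (1 - f z) * expS K (logS N (f z)) - 1.
pose D1 z := Q z * expS K (b z) - 1.
pose D2 z := expS K (b z) * expS K (b z)^* - expS K (logS N (f z)).
have QE : wiener [set m | 0 <= L m] E Q.
  apply: wiener_leB EE _; apply: wiener_expS.
  - by rewrite /= L0.
  - by move=> m m' /= m0 m'0; rewrite LD addr_ge0.
  - exact: wienerN bU.
have fV : wiener [set m | L m <= l] V (fun z => 1 - f z).
  apply: wienerD; first by rewrite -(nrm1 R); apply: wiener_cst; rewrite /= L0.
  by apply/wienerN; apply: wiener_leS fB => m /=; exact/le_trans/ler_norm.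
have PVE : wiener [set m | L m <= l] (V * E) P.
  apply: (wienerM (S' := [set m | L m <= 0]) _ fV).
    by move=> m m' /= ml m'0; rewrite LD -[l]addr0 lerD.
  apply: wiener_leB EE _; apply: wiener_expS.
  - by rewrite /= L0.
  - by move=> m m' /= ml m'0; rewrite LD -[0]addr0 lerD.
  - by apply: wiener_leS (wienerJ bU) => m /=; rewrite LN oppr_ge0.
have sT S M g : wiener S M g -> wiener setT M g by exact: wiener_le.
have GW : wiener setT eta G.
  apply: wiener_leB (le_trans (geometric_sum_le N.+1 n C0 s0 s1) tailN) _.
  rewrite (_ : G = fun z => \sum_(N.+1 <= k < n) c k * f z ^+ k); last first.
    by apply/funext => z; rewrite /G logE addrAC subrr add0r.
  apply: wiener_sum => k _; apply: wiener_leB (wienerZ (c k) (fpow k)).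
  rewrite ler_piMl ?(wiener_ge0 (fpow k))//.
  by rewrite -lecR nrmE (c1 k).
have bT := sT _ _ _ bU.
have D1W : wiener setT eta D1.
  apply: wiener_leB defK _.
  rewrite (_ : D1 = fun z => expS K (- b z) * expS K (b z) - expS K (- b z + b z)).
    by apply: wiener_expSM => //; exact: wienerN.
  by apply/funext => z; rewrite addNr expS0.
have D2W : wiener setT eta D2.
  apply: wiener_leB defK _.
  rewrite (_ : D2 = fun z => expS K (b z) * expS K (b z)^* - expS K (b z + (b z)^*)).
    by apply: wiener_expSM => //; exact: (sT _ _ _ (wienerJ bU)).
  by apply/funext => z; rewrite /D2 uE.
pose tau := eta * T.
have DW : wiener setT tau (fun z => Q z - P z).
  (* Passing from [Q] to [P] takes three replacements: 1 by (1 - f) exp (u) with error [G], exp (u)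
     by exp (b) exp (conj b) with error [D2], and Q exp (b) by 1 with error [D1]. *)
  rewrite (_ : (fun z => _) = fun z =>
    - (Q z * G z) + (- (Q z * ((1 - f z) * D2 z)) + P z * D1 z)); last first.
    by apply/funext => z; rewrite /D1 /D2 /G /P; ring.
  rewrite (_ : tau = E * eta + (E * (V * eta) + V * E * eta)); last first.
    by rewrite /tau /T; ring.
  have tM M1 M2 g h : wiener setT M1 g -> wiener setT M2 h ->
    wiener setT (M1 * M2) (fun z => g z * h z) by exact: wienerM.
  apply: wienerD; first by apply: wienerN; apply: tM => //; exact: sT QE.
  apply: wienerD; last by apply: tM => //; exact: sT PVE.
  by apply: wienerN; apply: (tM _ _ _ _ (sT _ _ _ QE)); apply: tM => //; exact: sT fV.
have [d1 [d2 [M1 [M2 [d1W d2W M12 DE]]]]] := wiener_split (fun m => L m <= l) DW.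
have M10 := wiener_ge0 d1W; have M20 := wiener_ge0 d2W.
(* Q - d2 = P + d1 inherits L >= 0 from Q and d2, and L <= l from P and d1. *)
exists (fun z => Q z - d2 z); split.
- exists (E + M2); apply: wienerD => //; apply: wienerN.
  apply: wiener_leS d2W => m [_] /=; rewrite -ltNge => /ltW; exact: le_trans.
- exists (V * E + M1); rewrite (_ : (fun z => _) = fun z => P z + d1 z).
    by apply: wienerD => //; apply: wiener_leS d1W => m [].
  by apply/funext => z; have := DE z => /(canRL (subrK _)) ->; ring.
move=> z; have QP : Q z - d2 z = P z + d1 z.
  by have := DE z => /(canRL (subrK _)) ->; ring.
(* Conjugating the form [P + d1] of the factor produces the main term (1 - f) Q exp (b), which is 1
   - f up to [D1]. *)
have -> : (Q z - d2 z) * (Q z - d2 z)^* - (1 - f z) =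
    (1 - f z) * D1 z + (Q z * (d1 z)^* - d2 z * (Q z - d2 z)^*).
  have PJ : (P z)^* = (1 - f z) * expS K (b z).
    by rewrite /P rmorphM rmorphB rmorph1 /= fJ expSJ conjCK.
  have -> : (Q z - d2 z)^* = (1 - f z) * expS K (b z) + (d1 z)^*.
    by rewrite QP rmorphD /= PJ.
  by rewrite /D1; ring.
have tau0 : 0 <= tau by rewrite mulr_ge0// ltW.
have nQ := nrm_wiener z QE; have nd1 := nrm_wiener z d1W; have nd2 := nrm_wiener z d2W.
have nD1 := nrm_wiener z D1W; have nf := nrm_wiener z fV.
have nq : nrm (Q z - d2 z) <= E + tau.
  by apply: (le_trans (nrmD _ _)); rewrite nrmN; lra.
have tauT : tau <= T by rewrite /tau ler_piMl.
apply: (le_trans (nrmD _ _)); apply: (@le_trans _ _ (V * eta + (E * tau + tau * (E + tau)))).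
  rewrite nrmM lerD ?ler_pM ?nrm_ge0//; apply: (le_trans (nrmD _ _)).
  rewrite nrmN !nrmM !nrmJ lerD ?ler_pM ?nrm_ge0//; lra.
apply: le_trans etaW; rewrite /W.
have : tau * (E + tau) <= tau * (E + T) by rewrite ler_wpM2l// lerD2l.
rewrite /tau; lra.
Qed.
End factorization.

(** * Frequencies in a strip *)

Section strip.
Variable R : realType.
Implicit Types (m n : int * int) (z : R * R) (f g t : R * R -> R[i]).

Definition height (alpha : R) m : R := m.2%:~R - m.1%:~R * alpha.

Lemma heightD alpha : {morph height alpha : m n / m + n}.
Proof. by move=> m n; rewrite /height !intrD; ring. Qed.

Lemma heightN alpha : {morph height alpha : m / - m}.
Proof. by move=> m; rewrite /height !intrN; ring. Qed.

(** The second row of a far matrix of the sequence gives, up to sign, the vector (- g22, g21). Its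
    height tends to 0 and is nonzero because [alpha] is irrational. *)
Lemma small_height alpha (d : R) : irrational alpha -> amply_approximable alpha ->
  0 < d -> exists m, 0 < height alpha m < d.
Proof.
move=> irr [g [_ g22 gln]] d0.
have /cvgrPdist_lt /(_ d d0) [N1 _ H1] := gln.
(* Once |q| >= e, both |q| and ln |q| are at least 1, so the small product dominates |p + alpha
   q|. *)
have /cvgryPge /(_ (expR 1)) [N2 _ H2] := g22.
pose N := maxn N1 N2; have {H1} := H1 N (leq_maxl _ _).
have {H2} /= := H2 N (leq_maxr _ _); set p := g N 1 0; set q := g N 1 1 => eq.
rewrite sub0r normrN /= -/p -/q => H.
have q1 : 1 <= `|q%:~R : R| by apply: le_trans eq; have := expR_ge1Dx (1 : R); lra.
have lnq : 1 <= ln `|q%:~R : R|.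
  by rewrite -[leLHS]expRK ler_ln ?posrE ?expR_gt0// (lt_le_trans ltr01).
have {}H : `|p%:~R + alpha * q%:~R| < d.
  apply: le_lt_trans H; rewrite !normrM !normr_id -mulrA ler_peMr//.
  by apply: mulr_ege1 => //; apply: le_trans lnq _; exact: ler_norm.
have q0 : q%:~R != 0 :> R by rewrite -normr_gt0 (lt_le_trans ltr01).
have pq0 : p%:~R + alpha * q%:~R != 0.
  apply/eqP => E; apply: irr; exists (- (p%:~R / q%:~R)) => //.
  rewrite rmorphN fmorph_div /= !ratr_int.
  apply: (mulIf q0); rewrite mulNr divfK//; apply/esym/eqP.
  by rewrite -addr_eq0 addrC E.
have hE : height alpha (- q, p) = p%:~R + alpha * q%:~R.
  by rewrite /height /= intrN; ring.
have [s0|s0] := ltP 0 (height alpha (- q, p)).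
  by exists (- q, p); rewrite s0 hE (le_lt_trans (ler_norm _)).
exists (- (- q, p)); rewrite heightN oppr_gt0 lt_neqAle s0 hE pq0 /=.
by move: H; rewrite -normrN; exact/le_lt_trans/ler_norm.
Qed.

(** Multiples of a positive height below b - a cannot jump over the interval; the first one beyond
    [a] is taken. *)
Lemma height_dense alpha (a b : R) : irrational alpha -> amply_approximable alpha ->
  a < b -> exists m, a < height alpha m < b.
Proof.
move=> irr amp ab; have [|m /andP[m0 mab]] := small_height irr amp (_ : 0 < b - a).
  by rewrite subr_gt0.
pose k := Num.floor (a / height alpha m) + 1.
exists (k * m.1, k * m.2).
have -> : height alpha (k * m.1, k * m.2) = k%:~R * height alpha m.
  by rewrite /height /= !intrM; ring.
have k1 : k%:~R <= a / height alpha m + 1 by rewrite intrD lerD2r ge_floor.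
have k2 : a / height alpha m < k%:~R by exact: lt_succ_floor.
rewrite -ltr_pdivrMr// k2 /=; apply: (@le_lt_trans _ _ (a + height alpha m)); last lra.
have -> : a + height alpha m = (a / height alpha m + 1) * height alpha m.
  by field; rewrite gt_eqF.
by rewrite ler_pM2r.
Qed.

(** * Uniform closure and the two inclusions *)

Lemma uniform_closureP (A : set (R * R -> R[i])) t :
  closure (A : set {uniform (R * R) -> (R[i])^o}) t <->
  forall e : R, 0 < e -> exists2 s, A s & forall z, nrm (t z - s z) < e.
Proof.
split=> [tA e e0|H B].
  have [|s [As /= sE]] := tA [set s | forall z, nrm (t z - s z) < e].
    apply/uniform_nbhs; exists [set xy | ball (xy.1 : (R[i])^o) e%:C xy.2]; split.
      rewrite -entourage_ballE; exists e%:C => //=; by rewrite ltcR.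
    move=> s H z; have := H z I; rewrite /ball /= -nrmE ltcR; exact.
  by exists s.
move=> /uniform_nbhs[E []]; rewrite -entourage_ballE => -[e /= e0 eE] EB.
(* Radii of balls in [R[i]] are positive elements of [R[i]], hence real. *)
have eR : e = (complex.Re e)%:C.
  by rewrite RRe_real// gtr0_real.
have [|s As sE] := H (complex.Re e); first by rewrite -ltcR -eR.
exists s; split => //; apply: EB => z _; apply: eE => /=.
by rewrite /ball /= -nrmE eR ltcR.
Qed.

(** Only finitely many frequencies occur, so a strict bound leaves a margin; it later gives the
    translation room to move. *)
Lemma wiener_lt (L : int * int -> R) S B f (c : R) : (forall m, S m -> `|L m| < c) ->
  0 < c -> wiener S B f -> exists l, [/\ 0 <= l, l < c & wiener [set m | `|L m| <= l] B f].
Proof.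
move=> SL c0 [r [rS rB fr]]; exists (\big[Num.max/0]_(x <- r) `|L x.2|); split.
- elim/big_rec: _ => // x y _ y0; by rewrite le_max y0 orbT.
- rewrite big_seq; elim/big_ind: _ => // [x y xc yc|x xr]; first by rewrite gt_max xc.
  exact/SL/rS.
- by exists r; split => // x xr /=; apply: (le_bigmax_seq _ _ _ (fun x => `|L x.2|) xr).
Qed.

(** Outside [S] the coefficients of [t] are those of t - g, which is uniformly small. *)
Lemma freq_approx S B g t m (e : R) :
  trig_poly t -> wiener S B g -> ~ S m -> (forall z, nrm (t z - g z) <= e) ->
  nrm (fourier_coef t m) <= e *+ 2.
Proof.
move=> /trig_polyP[r ->] /wienerN[r' [r'S _ gr']] Sm te.
have -> : fourier_coef (expansion r) m = fourier_coef (expansion (r ++ r')) m.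
  rewrite !fourier_coef_expansion big_cat /= [X in _ + X]big_seq_cond.
  rewrite [X in _ + X]big1 ?addr0// => x /andP[/r'S xS /eqP xm].
  by case: Sm; rewrite -xm.
apply: nrm_fourier_coef => z; rewrite /expansion big_cat /=.
by rewrite -/(expansion r z) -/(expansion r' z) -gr'.
Qed.

(** The square |s|^2 = s conj s is nonnegative with frequencies in F - F, and both properties
    survive uniform limits. *)
Lemma U2_subset F : @U2 R F `<=` pos_trig_poly_in (diff_set F).
Proof.
move=> t [tp /uniform_closureP tcl]; split; first split => // m mt.
  apply: contrapT => Fm; case/negP: mt; apply/eqP.
  suff : nrm (fourier_coef t m) <= 0.
    by rewrite -lecR nrmE normr_le0 => /eqP.
  apply/ler_addgt0Pl => e e0; rewrite addr0.
  have [|s [t1 [t1p t1F] ->] H] := tcl (e / 2); first by rewrite divr_gt0.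
  have [B t1B] := trig_poly_wiener t1p t1F.
  rewrite (_ : e = (e / 2) *+ 2); last by rewrite -mulr_natr divfK.
  apply: (@freq_approx (diff_set F) (B * B) (fun z => t1 z * (t1 z)^*)) => //.
    apply: (wienerM _ t1B (wienerJ t1B)) => a b Fa /= Fb.
    by exists a => //; exists (- b) => //; rewrite opprK.
  by move=> z; rewrite -normCK; exact/ltW/H.
(* The distance to the nonnegative reals bounds both the imaginary part and the negative part of the
   real part. *)
move=> z; have H (e : R) : 0 < e -> exists2 p : R[i], 0 <= p & nrm (t z - p) < e.
  move=> e0; have [s [t1 _ ->] /(_ z) H] := tcl e e0.
  by exists (`|t1 z| ^+ 2) => //; rewrite exprn_ge0.
rewrite lecE; apply/andP; split.
  rewrite /= -normr_le0; apply/ler_addgt0Pl => e e0; rewrite addr0.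
  have [p p0 /ltW pe] := H e e0; apply: le_trans pe.
  apply: le_trans (Im_le_nrm _); have := ger0_Im p0.
  by case: (t z) p {p0 H} => a b [c d] /= ->; rewrite subr0.
rewrite /= -oppr_le0; apply/ler_addgt0Pl => e e0; rewrite addr0.
have [p p0 /ltW pe] := H e e0; apply: le_trans pe.
apply: le_trans (Re_le_nrm _); move: p0; rewrite lecE => /andP[_].
case: (t z) p {H} => a b [c d] /= c0; rewrite -normrN.
by apply: le_trans (ler_norm _); lra.
Qed.

Lemma strip_diff_height (alpha beta : R) m :
  diff_set (strip alpha beta) m -> `|height alpha m| < 2 * beta.
Proof.
move=> [a Fa [b Fb <-]]; rewrite heightD heightN.
apply: le_lt_trans (ler_normB _ _) _.
have {}Fa : `|height alpha a| < beta by [].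
have {}Fb : `|height alpha b| < beta by [].
lra.
Qed.

Lemma pos_trig_poly_subset (alpha beta : R) :
  irrational alpha -> amply_approximable alpha -> 0 < beta ->
  @pos_trig_poly_in R (diff_set (strip alpha beta)) `<=` @U2 R (strip alpha beta).
Proof.
move=> irr amp beta0 t [[tp tF] t0]; split => //.
have [B tB] := trig_poly_wiener tp tF.
have [l [l0 lbeta tl]] : exists l, [/\ 0 <= l, l < 2 * beta &
    wiener [set m | `|height alpha m| <= l] B t].
  by apply: wiener_lt tB; [exact: strip_diff_height|rewrite mulr_gt0].
have B0 := wiener_ge0 tB.
apply/uniform_closureP => e e0.
(* Adding [eta] makes [t] strictly positive, and dividing by [c], an upper bound of t + eta, puts
   [f] in [0, 1 - eta / c]. The shift and the factorization then cost [eta] each, e / 2 in all. *)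
pose eta := e / 4; have eta0 : 0 < eta by rewrite divr_gt0.
pose c := B + eta; have c0 : 0 < c by rewrite ltr_wpDl.
have cn0 : c%:C != 0 :> R[i] by rewrite (inj_eq (@complexI _)) gt_eqF.
have tr z : t z = (complex.Re (t z))%:C by rewrite RRe_real// ger0_real.
have tr0 z : 0 <= complex.Re (t z) by rewrite -lecR -tr.
have trB z : complex.Re (t z) <= B.
  by apply: le_trans (nrm_wiener z tB); apply: le_trans (Re_le_nrm _); exact: ler_norm.
pose f z := 1 - (t z + eta%:C) / c%:C.
have fr z : f z = (1 - (complex.Re (t z) + eta) / c)%:C.
  have affine (x y d : R) : 1 - (x%:C + y%:C) / d%:C = (1 - (x + y) / d)%:C.
    by rewrite rmorphB rmorphM rmorphD fmorphV rmorph1.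
  by rewrite -affine -tr.
have [Bf fW] : exists Bf, wiener [set m | `|height alpha m| <= l] Bf f.
  eexists; rewrite (_ : f = fun z => (1 - eta%:C / c%:C) + - c%:C^-1 * t z); last first.
    by apply/funext => z; rewrite /f; field.
  apply: wienerD; last exact: wienerZ tl.
  by apply: wiener_cst; rewrite /height /= !mul0r subr0 normr0.
have [q [[B1 q1] [B2 q2] qE]] : exists q, [/\
    exists B', wiener [set m | 0 <= height alpha m] B' q,
    exists B', wiener [set m | height alpha m <= l] B' q &
    forall z, nrm (q z * (q z)^* - (1 - f z)) <= eta / c].
  apply: (@spectral_factorization R (height alpha) l Bf f (1 - eta / c)) => //.
  - exact: heightD.
  - by move=> z; rewrite fr; exact: conjc_real.
  - by rewrite gtrBl divr_gt0.
  - move=> z; rewrite fr nrmR ger0_norm.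
      by rewrite lerB// ler_pM2r ?invr_gt0// lerDr.
    by rewrite subr_ge0 ler_pdivrMr// mul1r lerD2r.
  - by rewrite divr_gt0.
(* The two one-sided supports come from different expansions of [q]; both constrain its Fourier
   coefficients, so inversion gives one expansion with both. *)
have [Bq qW] : exists B', wiener [set m | 0 <= height alpha m <= l] B' q.
  apply: trig_poly_wiener; first exact: wiener_trig_poly q1.
  move=> m qm; apply/andP; split.
    exact: (freq_wiener q1 qm).
  exact: (freq_wiener q2 qm).
(* The interval is nonempty since l < 2 beta. Translation by - m0 carries heights in [0, l] into (-
   beta, beta). *)
have [m0 /andP[m0l m0b]] : exists m, l - beta < height alpha m < beta.
  by apply: height_dense => //; lra.
pose s z := (Num.sqrt c)%:C * (e_ (- m0) z * q z).
have sW : exists B', wiener (strip alpha beta) B' s.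
  eexists; apply: wienerZ; apply: (wienerM (S := [set - m0]) _ _ qW); last exact: wiener_e.
  move=> _ n -> /= /andP[n0 nl].
  change (`|height alpha (- m0 + n)| < beta).
  by rewrite heightD heightN ltr_norml; apply/andP; split; lra.
have [Bs {}sW] := sW.
exists (fun z => `|s z| ^+ 2).
  by exists s => //; split; [exact: wiener_trig_poly sW|exact: freq_wiener sW].
move=> z; have -> : `|s z| ^+ 2 = c%:C * (q z * (q z)^*).
  rewrite /s !normrM !exprMn -!nrmE nrm_e nrmR ger0_norm ?sqrtr_ge0//.
  by rewrite -rmorphXn /= sqr_sqrtr ?(ltW c0)// rmorph1 expr1n mul1r nrmE normCK.
(* By the choice of [f], c (1 - f) = t + eta. *)
have -> : t z - c%:C * (q z * (q z)^*) =
    - (c%:C * (q z * (q z)^* - (1 - f z))) + - eta%:C.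
  by rewrite /f; field.
apply: le_lt_trans (nrmD _ _) _; rewrite !nrmN nrmM !nrmR !gtr0_norm//.
apply: (@le_lt_trans _ _ (c * (eta / c) + eta)).
  by rewrite lerD2r ler_pM2l.
by rewrite mulrC divfK ?gt_eqF// /eta; lra.
Qed.

End strip.

Theorem theorem3p3 (R : realType) (alpha beta : R) :
  irrational alpha -> amply_approximable alpha -> 0 < beta ->
  property_A R (strip alpha beta).
Proof.
move=> irr amp beta0; apply/seteqP; split; last exact: U2_subset.
exact: pos_trig_poly_subset.
Qed.
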